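(* Let $\mathbf{A}\in\mathbb{C}^{N\times N}$ be Hermitian and nonsingular (possibly indefinite), let $\mathbf{b},\mathbf{x}_0\in\mathbb{C}^N$, let $\mathbf{U}\in\mathbb{C}^{N\times k}$ have rank $k$, where $0<k<N$, let $\mathcal{U}:=\mathrm{im}(\mathbf{U})$, and set $$\mathbf{M}_{\mathbf{A}}:=\mathbf{U}(\mathbf{U}^{\mathsf H}\mathbf{A}^2\mathbf{U})^{-1}\mathbf{U}^{\mathsf H},\qquad \mathbf{P}_{\mathbf{A}}:=\mathbf{I}-\mathbf{A}\mathbf{M}_{\mathbf{A}}\mathbf{A},\qquad \mathbf{Q}_{\mathbf{A}}:=\mathbf{I}-\mathbf{M}_{\mathbf{A}}\mathbf{A}^2.$$ Consider the following two approaches: 1. The solver part of the RMINRES method (with augmentation space $\mathcal{U}$) applied to $\mathbf{A}\mathbf{x}=\mathbf{b}$ with the initial guess $\widehat{\mathbf{x}}_0:=\mathbf{P}_{\mathbf{A}}\mathbf{x}_0+\mathbf{A}\mathbf{M}_{\mathbf{A}}\mathbf{b}$ and resulting iterates $\mathbf{x}_n$ and residuals $\mathbf{r}_n=\mathbf{b}-\mathbf{A}\mathbf{x}_n$ ($n\ge1$). 2. The MINRES method applied to $\mathbf{P}_{\mathbf{A}}\mathbf{A}\mathbf{P}_{\mathbf{A}}\mathbf{x}=\mathbf{P}_{\mathbf{A}}\mathbf{Q}_{\mathbf{A}}^{\mathsf H}\mathbf{b}$ with the initial guess $\mathbf{x}_0$ and resulting iterates $\overline{\mathbf{x}}_n$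 and residuals $\overline{\mathbf{r}}_n:=\mathbf{P}_{\mathbf{A}}\mathbf{Q}_{\mathbf{A}}^{\mathsf H}\mathbf{b}-\mathbf{P}_{\mathbf{A}}\mathbf{A}\mathbf{P}_{\mathbf{A}}\overline{\mathbf{x}}_n$ ($n\ge1$). Both approaches are equivalent in the sense that, for each iteration step $n\geq 1$ (until termination), $$\mathbf{x}_n=\mathbf{Q}_{\mathbf{A}}(\mathbf{P}_{\mathbf{A}}\overline{\mathbf{x}}_n+\mathbf{A}\mathbf{M}_{\mathbf{A}}\mathbf{b})+\mathbf{M}_{\mathbf{A}}\mathbf{A}\mathbf{b}\qquad\text{and}\qquad\mathbf{r}_n=\overline{\mathbf{r}}_n.$$
   Context: For $\mathbf{C}\in\mathbb{C}^{N\times N}$ and $\mathbf{v}\in\mathbb{C}^N$, $\mathcal{K}_n(\mathbf{C},\mathbf{v}):=\mathrm{span}\{\mathbf{v},\mathbf{C}\mathbf{v},\dots,\mathbf{C}^{n-1}\mathbf{v}\}$, with $\mathcal{K}_0=\{\mathbf{0}\}$; $\perp$ is Euclidean orthogonality in $\mathbb{C}^N$. All methods are understood in exact arithmetic through the following mathematical characterizations. Solver part of RMINRES: applied to $\mathbf{A}\mathbf{x}=\mathbf{b}$ with augmentation space $\mathcal{U}$ and an initial guess $\mathbf{z}_0$, with $\mathbf{s}_0=\mathbf{b}-\mathbf{A}\mathbf{z}_0$, its $n$-th iterate $\mathbf{x}_n$ is determined by $$\mathbf{x}_n\in\mathbf{z}_0+\mathcal{K}_n(\mathbf{P}_{\mathbf{A}}\mathbf{A},\mathbf{P}_{\mathbf{A}}\mathbf{s}_0)+\mathcal{U},\qquad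 \mathbf{b}-\mathbf{A}\mathbf{x}_n\perp\mathbf{A}\mathcal{K}_n(\mathbf{P}_{\mathbf{A}}\mathbf{A},\mathbf{P}_{\mathbf{A}}\mathbf{s}_0)+\mathbf{A}\mathcal{U}.$$ MINRES: applied to a linear system $\mathbf{C}\mathbf{z}=\mathbf{c}$ with Hermitian (possibly singular) $\mathbf{C}$ and initial guess $\mathbf{z}_0$, with $\mathbf{s}_0=\mathbf{c}-\mathbf{C}\mathbf{z}_0$, its $n$-th iterate $\mathbf{z}_n$ is determined by $$\mathbf{z}_n\in\mathbf{z}_0+\mathcal{K}_n(\mathbf{C},\mathbf{s}_0),\qquad \mathbf{c}-\mathbf{C}\mathbf{z}_n\perp\mathbf{C}\mathcal{K}_n(\mathbf{C},\mathbf{s}_0).$$ The MINRES iteration runs over $n=1,\dots,d$, where $d\ge0$ is the smallest integer with $\mathcal{K}_{d+1}(\mathbf{C},\mathbf{s}_0)=\mathcal{K}_d(\mathbf{C},\mathbf{s}_0)$, and terminates at step $d$. *)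

(* Defs.v *)
From HB Require Import structures.
From mathcomp Require Import all_boot all_order all_algebra.
From mathcomp Require Import reals.
From mathcomp Require Import complex.

Set Implicit Arguments.
Unset Strict Implicit.
Unset Printing Implicit Defensive.

Import Order.TTheory GRing.Theory Num.Theory.
Local Open Scope ring_scope.
Local Open Scope sesquilinear_scope.

(* The field C of complex numbers enters only through its numClosedFieldType
   structure; the statement takes C := R[i] with R : realType. *)
Section Krylov.
Variables (C : numClosedFieldType) (N : nat).
Implicit Types (B : 'M[C]_N) (v z : 'cV[C]_N) (S W : {vspace 'cV[C]_N}).

Definition krylov B v (n : nat) : {vspace 'cV[C]_N} :=
  <<[seq B ^+ i *m v | i <- iota 0 n]>>%VS.

(* The image B S of a subspace S of C^N under v |-> B v. *)
Definition mximg B S : {vspace 'cV[C]_N} := (linfun (mulmx B) @: S)%VS.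

(* The column space of U. *)
Definition colimg (k : nat) (U : 'M[C]_(N, k)) : {vspace 'cV[C]_N} :=
  limg (linfun (mulmx U : 'cV[C]_k -> 'cV[C]_N)).

Definition cV_orthogonal v W : Prop :=
  forall w, w \in W -> w^t* *m v = 0 :> 'M[C]_1.

(* Membership of z in an affine space z0 + S is written z - z0 \in S. *)
Definition minres_iterate B (c z0 : 'cV[C]_N) (n : nat) z : Prop :=
  let K := krylov B (c - B *m z0) n in
  z - z0 \in K /\ cV_orthogonal (c - B *m z) (mximg B K).

Definition minres_terminates_at B (c z0 : 'cV[C]_N) (d : nat) : Prop :=
  let K := krylov B (c - B *m z0) in
  K d.+1 = K d /\ forall m : nat, K m.+1 = K m -> (d <= m)%N.

Section Deflation.
Variables (k : nat) (A : 'M[C]_N) (U : 'M[C]_(N, k)).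

Definition deflM : 'M[C]_N := U *m invmx (U^t* *m A ^+ 2 *m U) *m U^t*.

Definition deflP : 'M[C]_N := 1%:M - A *m deflM *m A.

Definition deflQ : 'M[C]_N := 1%:M - deflM *m A ^+ 2.

Definition rminres_iterate (b z0 : 'cV[C]_N) (n : nat) z : Prop :=
  let K := krylov (deflP *m A) (deflP *m (b - A *m z0)) n in
  z - z0 \in (K + colimg U)%VS /\
  cV_orthogonal (b - A *m z) (mximg A K + mximg A (colimg U))%VS.

End Deflation.
End Krylov.

(* Main.v *)
Require Import Defs.
From HB Require Import structures.
From mathcomp Require Import all_boot all_order all_algebra.
From mathcomp Require Import reals.
From mathcomp Require Import complex.

(** Let [y] be the right-hand side of the first identity.  Since [A Q = P A] and
    [P A U = 0], one finds [b - A y = P b - P A P xbar - P A A M b], which is the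
    residual of [xbar].  At the initial guesses the same computation shows that
    the two methods start from the same vector, which lies in the range of the
    orthogonal projection [P]; hence both use the same Krylov space [K], and
    [P K = K].  This makes [y] satisfy the two conditions defining the RMINRES
    iterate.  As [A] is nonsingular, these conditions have at most one solution,
    so that [y = x]. *)

Set Implicit Arguments.
Unset Strict Implicit.
Unset Printing Implicit Defensive.

Import Order.TTheory GRing.Theory Num.Theory.
Local Open Scope ring_scope.
Local Open Scope sesquilinear_scope.

Section ConjugateTranspose.
Variable C : numClosedFieldType.

Lemma trmxC_mul (m n p : nat) (X : 'M[C]_(m, n)) (Y : 'M[C]_(n, p)) :
  (X *m Y)^t* = Y^t* *m X^t*.
Proof. by rewrite trmx_mul map_mxM. Qed.

Lemma trmxCB (m n : nat) (X Y : 'M[C]_(m, n)) : (X - Y)^t* = X^t* - Y^t*.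
Proof. by rewrite linearB /= map_mxB. Qed.

Lemma trmxC1 (n : nat) : (1%:M : 'M[C]_n)^t* = 1%:M.
Proof. by rewrite trmx1 map_mx1. Qed.

Lemma trmxC_inv (n : nat) (X : 'M[C]_n) : (invmx X)^t* = invmx (X^t*).
Proof. by rewrite trmx_inv map_invmx. Qed.

Lemma hermsymmx_trmxC (n : nat) (X : 'M[C]_n) : X \is hermsymmx -> X^t* = X.
Proof. by move=> /is_hermitianmxP; rewrite expr0 scale1r => <-. Qed.

(** Each diagonal entry of the Gram matrix is the sum of the squared moduli of a column of [X]; a
    vanishing sum of nonnegative terms has only zero terms. *)
Lemma gram_eq0 (m n : nat) (X : 'M[C]_(m, n)) : X^t* *m X = 0 -> X = 0.
Proof.
move=> X0; apply/matrixP => i j; rewrite mxE; apply/eqP.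
have /eqP := congr1 (fun Y : 'M_n => Y j j) X0; rewrite !mxE.
rewrite psumr_eq0 => [/allP /(_ i (mem_index_enum _))|l _].
  by rewrite !mxE mulf_eq0 conjC_eq0 orbb.
by rewrite !mxE mulrC mul_conjC_ge0.
Qed.

(** A row vector [v] killed by the Gram matrix makes [X *m v^t*] a matrix with zero Gram matrix,
    hence zero, and full column rank then forces [v = 0]. *)
Lemma gram_unitmx (m n : nat) (X : 'M[C]_(m, n)) :
  \rank X = n -> X^t* *m X \in unitmx.
Proof.
move=> rX; rewrite -row_free_unit; apply: inj_row_free => v vG0.
have Xv0 : X *m v^t* = 0.
  by apply: gram_eq0; rewrite trmxC_mul trmxCK mulmxA -(mulmxA v) vG0 mul0mx.
apply/eqP; rewrite -(@mulmx_free_eq0 _ _ _ _ v (X^t*)).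
  by rewrite -[v]trmxCK -trmxC_mul Xv0 trmx0 map_mx0.
by rewrite /row_free mxrank_map mxrank_tr rX.
Qed.

End ConjugateTranspose.

Section Krylov.
Variables (C : numClosedFieldType) (N : nat).
Implicit Types (B : 'M[C]_N) (v w : 'cV[C]_N) (S W : {vspace 'cV[C]_N}).

Lemma mem_mximg B S v : v \in S -> B *m v \in mximg B S.
Proof.
by move=> vS; apply/memv_imgP; exists v; rewrite ?lfunE.
Qed.

Lemma mximgP B S w : reflect (exists2 v, v \in S & w = B *m v) (w \in mximg B S).
Proof.
by apply: (iffP memv_imgP) => -[v vS ->]; exists v; rewrite ?lfunE.
Qed.

Lemma colimgP (k : nat) (U : 'M[C]_(N, k)) w :
  reflect (exists u : 'cV[C]_k, w = U *m u) (w \in colimg U).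
Proof.
by apply: (iffP memv_imgP) => [[u _ ->]|[u ->]]; exists u; rewrite ?memvf ?lfunE.
Qed.

Lemma mximgD B S W : mximg B (S + W) = (mximg B S + mximg B W)%VS.
Proof. exact: limgD. Qed.

Lemma cV_orthogonalD v S W :
  cV_orthogonal v S -> cV_orthogonal v W -> cV_orthogonal v (S + W)%VS.
Proof.
move=> vS vW _ /memv_addP[s sS [w wW ->]].
by rewrite linearD /= map_mxD mulmxDl vS // vW // addr0.
Qed.

Lemma cV_orthogonalB v w S :
  cV_orthogonal v S -> cV_orthogonal w S -> cV_orthogonal (v - w) S.
Proof. by move=> vS wS s sS; rewrite mulmxBr vS // wS // subr0. Qed.

(** The difference of the two residuals is [B *m (w - v)]. It lies in the image of [S] under [B] and
    is orthogonal to that image, hence to itself. *)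
Lemma minimal_residual_unique B (c z0 : 'cV[C]_N) S v w :
    B \in unitmx -> v - z0 \in S -> w - z0 \in S ->
    cV_orthogonal (c - B *m v) (mximg B S) ->
    cV_orthogonal (c - B *m w) (mximg B S) -> v = w.
Proof.
move=> uB vS wS ov ow.
have dS : w - v \in S.
  by have := memvB wS vS; rewrite opprB addrA subrK.
have := cV_orthogonalB ov ow (mem_mximg B dS).
rewrite opprB [_ + (_ - c)]addrC subrKA -mulmxBr => /gram_eq0 d0.
by apply/esym/eqP; rewrite -subr_eq0 -[_ - _](mulKmx uB) d0 mulmx0.
Qed.

Section Projection.
Variables (P B : 'M[C]_N) (v : 'cV[C]_N).
Hypotheses (PP : P *m P = P) (Pv : P *m v = v).

Lemma projected_power i : P *m ((P *m B) ^+ i *m v) = (P *m B) ^+ i *m v.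
Proof.
case: i => [|i]; first by rewrite expr0 mul1mx.
by rewrite exprS -!mulmxE !mulmxA PP.
Qed.

Lemma projected_krylov n w : w \in krylov (P *m B) v n -> P *m w = w.
Proof.
move=> /coord_span ->; rewrite mulmx_sumr; apply: eq_bigr => i _.
by rewrite -scalemxAr (nth_map 0%N) ?size_iota // projected_power.
Qed.

(** The trailing factor [P] only ever meets vectors of the form [(P *m B) ^+ i *m v], all of which
    it fixes. *)
Lemma krylov_projected n : krylov (P *m B *m P) v n = krylov (P *m B) v n.
Proof.
congr <<_>>%VS; apply: eq_map; elim=> [|i IHi]; first by rewrite !expr0.
by rewrite !exprS -!mulmxE -[LHS]mulmxA IHi -[LHS]mulmxA projected_power !mulmxA.
Qed.

End Projection.
End Krylov.

Section Deflation.
Variables (C : numClosedFieldType) (N k : nat).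
Variables (A : 'M[C]_N) (U : 'M[C]_(N, k)).
Hypotheses (hermA : A \is hermsymmx) (unitA : A \in unitmx).
Hypothesis rankU : \rank U = k.

Local Notation M := (deflM A U).
Local Notation P := (deflP A U).
Local Notation Q := (deflQ A U).

(** As [A] is Hermitian, this is the Gram matrix of [A *m U], whose rank is still [k] because [A] is
    invertible. *)
Lemma defl_gram_unitmx : U^t* *m A ^+ 2 *m U \in unitmx.
Proof.
have -> : U^t* *m A ^+ 2 *m U = (A *m U)^t* *m (A *m U).
  by rewrite trmxC_mul (hermsymmx_trmxC hermA) expr2 -mulmxE !mulmxA.
by apply: gram_unitmx; rewrite eqmxMfull ?row_full_unit.
Qed.

Lemma deflM_trmxC : M^t* = M.
Proof.
by rewrite /deflM !(trmxC_mul, trmxC_inv, trmxCK, expr2, =^~ mulmxE,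
  hermsymmx_trmxC hermA, mulmxA).
Qed.

Lemma deflM_sqrA_U : M *m A *m A *m U = U.
Proof.
rewrite /deflM -[in RHS](mulmx1 U) -(mulVmx defl_gram_unitmx).
by rewrite expr2 -mulmxE !mulmxA.
Qed.

Lemma deflM_sqrA_deflM : M *m A *m A *m M = M.
Proof. by rewrite {2}/deflM !mulmxA deflM_sqrA_U /deflM expr2 -mulmxE !mulmxA. Qed.

Lemma deflM_colimg v : M *m v \in colimg U.
Proof.
apply/colimgP; exists (invmx (U^t* *m A ^+ 2 *m U) *m U^t* *m v).
by rewrite /deflM -!mulmxA.
Qed.

Lemma deflP_trmxC : P^t* = P.
Proof.
rewrite /deflP trmxCB trmxC1 2!trmxC_mul deflM_trmxC.
by rewrite (hermsymmx_trmxC hermA) mulmxA.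
Qed.

(* Generalizing [deflM A U] keeps [mulmxA] from unfolding it; the same device
   is used for [deflP] and [deflQ] further down. *)
Lemma deflP_idem : P *m P = P.
Proof.
rewrite /deflP; move: (deflM A U) deflM_sqrA_deflM => M0 MAAM.
rewrite mulmxBl mul1mx mulmxBr mulmx1 !mulmxA.
have -> : A *m M0 *m A *m A *m M0 = A *m M0 by rewrite -[in RHS]MAAM !mulmxA.
by rewrite subrr subr0.
Qed.

Lemma deflP_A_U : P *m A *m U = 0.
Proof.
rewrite /deflP; move: (deflM A U) deflM_sqrA_U => M0 MAAU.
by rewrite !mulmxBl mul1mx -[in A *m U]MAAU !mulmxA subrr.
Qed.

Lemma A_deflQ : A *m Q = P *m A.
Proof.
by rewrite /deflP /deflQ mulmxBr mulmx1 mulmxBl mul1mx expr2 -mulmxE !mulmxA.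
Qed.

Lemma deflP_deflQ_trmxC : P *m Q^t* = P - P *m A *m A *m M.
Proof.
rewrite /deflQ trmxCB trmxC1 trmxC_mul deflM_trmxC expr2 -mulmxE trmxC_mul.
by rewrite (hermsymmx_trmxC hermA) mulmxBr mulmx1 !mulmxA.
Qed.

Variables (b x0 : 'cV[C]_N).
Local Notation xhat0 := (P *m x0 + A *m M *m b).
Local Notation Abar := (P *m A *m P).
Local Notation bbar := (P *m Q^t* *m b).

Lemma initial_residual : P *m (b - A *m xhat0) = bbar - Abar *m x0.
Proof.
move: P Q M deflP_deflQ_trmxC => P0 Q0 M0 PQ.
rewrite PQ mulmxBr !mulmxDr mulmxBl !mulmxA.
by rewrite opprD addrA addrAC.
Qed.

Lemma lifted_residual z :
  b - A *m (Q *m (P *m z + A *m M *m b) + M *m A *m b) = bbar - Abar *m z.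
Proof.
have Pb : P *m b = b - A *m M *m A *m b by rewrite mulmxBl mul1mx.
move: P Q M deflP_deflQ_trmxC A_deflQ Pb => P0 Q0 M0 PQ AQ Pb.
rewrite PQ mulmxDr mulmxA AQ mulmxDr mulmxBl Pb !mulmxA.
rewrite !opprD !addrA.
by rewrite [LHS]addrAC (addrAC b) [LHS]addrAC.
Qed.

Lemma deflP_residual z : P *m (bbar - Abar *m z) = bbar - Abar *m z.
Proof. by move: P Q deflP_idem => P0 Q0 PP; rewrite mulmxBr !mulmxA PP. Qed.

(** This splits the update along the RMINRES search space: the first summand will lie in the Krylov
    space, the second in the range of [M], hence in that of [U]. *)
Lemma lifted_update z :
  let w := P *m z + A *m M *m b in
  Q *m w + M *m A *m b - xhat0 = P *m (z - x0) + M *m (A *m b - A ^+ 2 *m w).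
Proof.
rewrite /deflQ; move: P M (A ^+ 2) => P0 M0 A2.
set w := _ *m z + _.
have -> : P0 *m (z - x0) = w - (P0 *m x0 + A *m M0 *m b).
  by rewrite mulmxBr /w opprD addrACA subrr addr0.
by rewrite mulmxBl mul1mx [in RHS]mulmxBr !mulmxA
  [LHS]addrAC (addrAC w) -[LHS]addrA (addrC (- _)).
Qed.

Lemma lifted_minres_iterate n xbar :
  minres_iterate Abar bbar x0 n xbar ->
  rminres_iterate A U b xhat0 n (Q *m (P *m xbar + A *m M *m b) + M *m A *m b).
Proof.
have Pr0 := deflP_residual x0.
rewrite /minres_iterate /rminres_iterate lifted_residual initial_residual.
rewrite (krylov_projected _ deflP_idem Pr0) => -[xbarK oK].
have PK w := @projected_krylov _ _ _ A _ deflP_idem Pr0 n w.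
split.
  by rewrite lifted_update PK // memv_add // deflM_colimg.
apply: cV_orthogonalD => _ /mximgP[w wS ->].
  (* The residual is fixed by the Hermitian [P], so [P] can be moved onto the test vector [A *m w].
     Writing [w] as [P *m w] turns the result into [P *m A *m P *m w], a MINRES test vector. *)
  rewrite -deflP_residual mulmxA -[X in _ *m X *m _]deflP_trmxC -trmxC_mul.
  by rewrite -(PK _ wS) !mulmxA; apply: oK; apply: mem_mximg.
have [u ->] := colimgP _ _ wS.
(* Here moving [P] onto the test vector annihilates it. *)
rewrite -deflP_residual mulmxA -[X in _ *m X *m _]deflP_trmxC -trmxC_mul.
by rewrite !mulmxA deflP_A_U mul0mx trmx0 map_mx0 mul0mx.
Qed.

End Deflation.

Theorem theorem6p2 (R : realType) (N k : nat)
    (A : 'M[R[i]]_N) (b x0 : 'cV[R[i]]_N) (U : 'M[R[i]]_(N, k))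
    (hermA : A \is hermsymmx) (unitA : A \in unitmx)
    (k_gt0 : (0 < k)%N) (k_ltN : (k < N)%N) (rankU : \rank U = k) :
  let M := deflM A U in
  let P := deflP A U in
  let Q := deflQ A U in
  let xhat0 := P *m x0 + A *m M *m b in
  let Abar := P *m A *m P in
  let bbar := P *m Q^t* *m b in
  forall d : nat, minres_terminates_at Abar bbar x0 d ->
  forall n : nat, (1 <= n <= d)%N ->
  forall x xbar : 'cV[R[i]]_N,
    rminres_iterate A U b xhat0 n x ->
    minres_iterate Abar bbar x0 n xbar ->
    x = Q *m (P *m xbar + A *m M *m b) + M *m A *m b /\
    b - A *m x = bbar - Abar *m xbar.
Proof.
move=> M P Q xhat0 Abar bbar d _ n _ x xbar [xK ox].
move=> /(lifted_minres_iterate hermA unitA rankU)[yK oy].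
have -> : x = Q *m (P *m xbar + A *m M *m b) + M *m A *m b.
  (* Both vectors are compared over the search space [K + colimg U]; [mximgD] identifies its image
     under [A] with the RMINRES test space. *)
  by apply: (minimal_residual_unique unitA xK yK); rewrite mximgD;
    [exact: ox | exact: oy].
by split=> //; exact: lifted_residual.
Qed.
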